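(* Let $N\ge 1$ be an integer and let $\gamma,\alpha_{\rm Q},\alpha_{\rm M},\lambda_{\rm b},\lambda_{\rm s}>0$. Consider the system of ODEs for $x_i=x_i(\tau)$, $y_i=y_i(\tau)$, $1\le i\le N$, $\tau>0$: $$\begin{aligned} \dot x_1&=\lambda_{\rm b}-(\alpha_{\rm Q}+\alpha_{\rm M})x_1-\gamma\min[x_1,y_1],\\ \dot x_i&=\alpha_{\rm M}x_{i-1}-(\alpha_{\rm Q}+\alpha_{\rm M})x_i-\gamma\min[x_i,y_i],\quad 1<i\le N,\\ \dot y_i&=\alpha_{\rm M}y_{i+1}-(\alpha_{\rm Q}+\alpha_{\rm M})y_i-\gamma\min[x_i,y_i],\quad 1\le i<N,\\ \dot y_N&=\lambda_{\rm s}-(\alpha_{\rm Q}+\alpha_{\rm M})y_N-\gamma\min[x_N,y_N]. \end{aligned}$$ For every initial datum $(\boldsymbol x(0),\boldsymbol y(0))\in\mathbb R_+^N\times\mathbb R_+^N$ there exists a unique solution $\{(\boldsymbol x(\tau),\boldsymbol y(\tau)),\ \tau>0\}$ of this system with that initial datum, and $(\boldsymbol x(\tau),\boldsymbol y(\tau))\in\mathbb R_+^N\times\mathbb R_+^N$ for all $\tau>0$. Moreover, the fixed-point system $$\begin{aligned} \lambda_{\rm b}&=(\alpha_{\rm Q}+\alpha_{\rm M})x^*_1+\gamma\min[x^*_1,y^*_1],\\ \alpha_{\rm M}x^*_{i-1}&=(\alpha_{\rm Q}+\alpha_{\rm M})x^*_i+\gamma\min[x^*_i,y^*_i],\quad 1<i\le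 N,\\ \alpha_{\rm M}y^*_{i+1}&=(\alpha_{\rm Q}+\alpha_{\rm M})y^*_i+\gamma\min[x^*_i,y^*_i],\quad 1\le i<N,\\ \lambda_{\rm s}&=(\alpha_{\rm Q}+\alpha_{\rm M})y^*_N+\gamma\min[x^*_N,y^*_N] \end{aligned}$$ has a unique solution $(\boldsymbol x^*,\boldsymbol y^* )$, and for every such initial datum $$\mathrm{dist}\big[(\boldsymbol x(\tau),\boldsymbol y(\tau)),(\boldsymbol x^*,\boldsymbol y^* )\big]\to 0\qquad\text{as }\tau\to\infty.$$
   Context: $\mathbb R_+=(0,\infty)$, so $\mathbb R_+^N$ is the open positive orthant. $\boldsymbol x=(x_1,\dots,x_N)$, $\boldsymbol y=(y_1,\dots,y_N)$, $\boldsymbol x^*=(x_1^*,\dots,x_N^* )$, $\boldsymbol y^*=(y_1^*,\dots,y_N^* )$. $\mathrm{dist}$ is the Euclidean distance in $\mathbb R^N\times\mathbb R^N$. *)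

(* Defs.v *)
From mathcomp Require Import all_boot all_order all_algebra.
From mathcomp Require Import all_classical all_reals all_analysis.

Set Implicit Arguments.
Unset Strict Implicit.
Unset Printing Implicit Defensive.

Import Order.TTheory GRing.Theory Num.Theory.
Import numFieldNormedType.Exports.

Local Open Scope classical_set_scope.
Local Open Scope ring_scope.

(* Coordinates are numbered from 0: the coordinate i of 'I_N is the one of
   index i + 1 in the usual numbering 1, ..., N. *)

Definition pos_vec (R : realType) (N : nat) (x : 'rV[R]_N) : Prop :=
  forall i, 0 < x 0 i.

(* The norm of the library on 'rV[R]_N is the sup norm. *)
Definition euclid_dist (R : realType) (N : nat) (p q : 'rV[R]_N * 'rV[R]_N) : R :=
  Num.sqrt (\sum_(i < N) (p.1 0 i - q.1 0 i) ^+ 2 +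
            \sum_(i < N) (p.2 0 i - q.2 0 i) ^+ 2).

Definition ode_at (R : realType) (N : nat)
    (gamma alphaQ alphaM lambdab lambdas : R)
    (x y : R -> 'rV[R]_N) (t : R) : Prop :=
  [/\ forall i : 'I_N, i = 0%N :> nat ->
        is_derive t (1 : R) (fun s => x s 0 i)
          (lambdab - (alphaQ + alphaM) * x t 0 i
           - gamma * Num.min (x t 0 i) (y t 0 i)),
      forall i j : 'I_N, i = j.+1 :> nat ->
        is_derive t (1 : R) (fun s => x s 0 i)
          (alphaM * x t 0 j - (alphaQ + alphaM) * x t 0 i
           - gamma * Num.min (x t 0 i) (y t 0 i)),
      forall i j : 'I_N, j = i.+1 :> nat ->
        is_derive t (1 : R) (fun s => y s 0 i)
          (alphaM * y t 0 j - (alphaQ + alphaM) * y t 0 i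
           - gamma * Num.min (x t 0 i) (y t 0 i))
    & forall i : 'I_N, i.+1 = N ->
        is_derive t (1 : R) (fun s => y s 0 i)
          (lambdas - (alphaQ + alphaM) * y t 0 i
           - gamma * Num.min (x t 0 i) (y t 0 i))].

(* The values of x and y at negative times are irrelevant. The initial datum is
   attained continuously from the right. *)
Definition ode_solution (R : realType) (N : nat)
    (gamma alphaQ alphaM lambdab lambdas : R) (x0 y0 : 'rV[R]_N)
    (x y : R -> 'rV[R]_N) : Prop :=
  [/\ x 0 = x0 /\ y 0 = y0,
      forall i : 'I_N, x t 0 i @[t --> 0^'+] --> x0 0 i,
      forall i : 'I_N, y t 0 i @[t --> 0^'+] --> y0 0 i
    & forall t : R, 0 < t ->
        ode_at gamma alphaQ alphaM lambdab lambdas x y t].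

Definition fixed_point_system (R : realType) (N : nat)
    (gamma alphaQ alphaM lambdab lambdas : R) (xs ys : 'rV[R]_N) : Prop :=
  [/\ forall i : 'I_N, i = 0%N :> nat ->
        lambdab = (alphaQ + alphaM) * xs 0 i
                  + gamma * Num.min (xs 0 i) (ys 0 i),
      forall i j : 'I_N, i = j.+1 :> nat ->
        alphaM * xs 0 j = (alphaQ + alphaM) * xs 0 i
                          + gamma * Num.min (xs 0 i) (ys 0 i),
      forall i j : 'I_N, j = i.+1 :> nat ->
        alphaM * ys 0 j = (alphaQ + alphaM) * ys 0 i
                          + gamma * Num.min (xs 0 i) (ys 0 i)
    & forall i : 'I_N, i.+1 = N ->
        lambdas = (alphaQ + alphaM) * ys 0 i
                  + gamma * Num.min (xs 0 i) (ys 0 i)].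

(* Main.v *)
(* Write K = alphaQ + alphaM + gamma. The system reads z' = B z - K z on the
   2N coordinates, where B is Lipschitz for the l1 norm with constant
   b = alphaM + gamma < K: the shifts cost alphaM, and the pair
   (x - min(x, y), y - min(x, y)) is an l1 contraction of (x, y). Hence
   (exp(K t) (z - w))' = exp(K t) (B z - B w), and Gronwall's lemma shows that
   two solutions approach each other in l1 like exp(-(K - b) t), which is
   exp(-alphaQ t). This gives uniqueness, and convergence once a fixed point is
   known; the fixed points solve v = B v / K, where B / K is a strict l1
   contraction. Existence is Picard iteration, and positivity follows coordinate
   by coordinate from the monotonicity of exp(K t) z_k wherever B z_k >= 0. *)
Require Import Defs.
From mathcomp Require Import all_boot all_order all_algebra.
From mathcomp Require Import all_classical all_reals all_analysis.
From mathcomp Require Import ring lra.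

Set Implicit Arguments.
Unset Strict Implicit.
Unset Printing Implicit Defensive.

Import Order.TTheory GRing.Theory Num.Theory.
Import numFieldNormedType.Exports.

Local Open Scope classical_set_scope.
Local Open Scope ring_scope.

(** * Real-variable preliminaries *)

Lemma norm_le_sum (R : realType) (I : finType) (f : I -> R) (k : I) :
  `|f k| <= \sum_j `|f j|.
Proof. by rewrite (bigD1 k)//= lerDl sumr_ge0. Qed.

Lemma sum_norm_eq0 (R : realType) (I : finType) (f : I -> R) :
  \sum_k `|f k| <= 0 -> forall k, f k = 0.
Proof.
move=> f0 k; apply/eqP; rewrite -normr_le0; apply: le_trans f0.
exact: norm_le_sum.
Qed.

(** Derivatives are known only for t > 0, so monotonicity reaches the endpoint 0 through continuity
    there. *)
Lemma is_derive_nondecreasing (R : realType) (f df : R -> R) :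
  continuous f ->
  (forall t : R, 0 < t -> is_derive t (1 : R) f (df t)) ->
  (forall t : R, 0 < t -> 0 <= df t) ->
  forall t : R, 0 <= t -> f 0 <= f t.
Proof.
move=> cf dF df0 t t0.
apply: (@ger0_derive1_ndecry R f 0) => //.
- by move=> x; rewrite in_itv/= andbT => /dF dx; exact: ex_derive.
- move=> x; rewrite in_itv/= andbT => x0; rewrite derive1E.
  by have := dF _ x0 => dx; rewrite derive_val df0.
- exact: continuous_subspaceT.
Qed.

Lemma is_derive_le (R : realType) (f g df dg : R -> R) :
  continuous f -> continuous g ->
  (forall t : R, 0 < t -> is_derive t (1 : R) f (df t)) ->
  (forall t : R, 0 < t -> is_derive t (1 : R) g (dg t)) ->
  (forall t : R, 0 < t -> df t <= dg t) -> f 0 <= g 0 ->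
  forall t : R, 0 <= t -> f t <= g t.
Proof.
move=> cf cg Df Dg dfg fg0 t t0.
have := @is_derive_nondecreasing R (g - f) (fun t => dg t - df t).
rewrite !fctE => /(_ _ _ _ t t0) H.
suff : g 0 - f 0 <= g t - f t by lra.
apply: H.
- by move=> x; apply: cvgB; [exact: cg|exact: cf].
- by move=> s s0; apply: is_deriveB; [exact: Dg|exact: Df].
- by move=> s s0; rewrite subr_ge0 dfg.
Qed.

(** Comparing [f] with [g] and [- g] with [f] replaces the integral bound
    $|f(t)|\le|f(0)|+\int_0^t|f'|$, with [g] in the part of the right-hand side. *)
Lemma is_derive_norm_le (R : realType) (f g df dg : R -> R) :
  continuous f -> continuous g ->
  (forall t : R, 0 < t -> is_derive t (1 : R) f (df t)) ->
  (forall t : R, 0 < t -> is_derive t (1 : R) g (dg t)) ->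
  (forall t : R, 0 < t -> `|df t| <= dg t) -> `|f 0| <= g 0 ->
  forall t : R, 0 <= t -> `|f t| <= g t.
Proof.
move=> cf cg Df Dg dfg; rewrite ler_norml => /andP[fg0 fg0'] t t0.
rewrite ler_norml; apply/andP; split.
- suff : (- g) t <= f t by [].
  apply: (@is_derive_le R (- g) f (fun t => - dg t) df) => //.
  + by move=> x; apply: cvgN; exact: cg.
  + by move=> s s0; apply: is_deriveN; exact: Dg.
  + by move=> s /dfg; rewrite ler_norml => /andP[].
- apply: (@is_derive_le R f g df dg) => //.
  by move=> s /dfg; rewrite ler_norml => /andP[].
Qed.

Lemma is_derive_expRM (R : realType) (a t : R) :
  is_derive t (1 : R) (fun s => expR (a * s)) (a * expR (a * t)).
Proof.
have H1 : is_derive t (1 : R) (fun s : R => a * s) a.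
  have H := @is_deriveZ R R R id a t 1 1 (is_derive_id _ _).
  by rewrite /GRing.scale /= mulr1 in H.
have H2 := is_derive_expR (a * t).
by rewrite mulrC; exact: (is_derive1_comp H2 H1).
Qed.

Lemma continuous_expRM (R : realType) (a : R) :
  continuous (fun s => expR (a * s)).
Proof.
move=> t; apply/differentiable_continuous/derivable1_diffP.
by have := is_derive_expRM a t => H; exact: ex_derive.
Qed.

(** The derivative of $q(s)e^{-bs}$ is $e^{-bs}(q'(s)-b\,q(s))\le 0$. *)
Lemma is_derive_gronwall (R : realType) (q dq : R -> R) (b : R) :
  continuous q ->
  (forall t : R, 0 < t -> is_derive t (1 : R) q (dq t)) ->
  (forall t : R, 0 < t -> dq t <= b * q t) ->
  forall t : R, 0 <= t -> q t <= q 0 * expR (b * t).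
Proof.
move=> cq Dq dqb t t0.
(* The first two terms cancel; what remains says $q(t)e^{-bt}\le q(0)$. *)
have H : q 0 - q 0 * expR (- b * 0) + q t * expR (- b * t) <= q 0.
  pose p := (fun s => q s * expR (- b * s)).
  suff : p t <= cst (q 0) t by rewrite /p /= mulr0 expR0 mulr1 subrr add0r.
  apply: (@is_derive_le R p (cst (q 0))
    (fun s => expR (- b * s) * (dq s - b * q s)) (cst 0)) => //=.
  - by move=> x; apply: cvgM; [exact: cq|exact: continuous_expRM].
  - by move=> x; exact: cvg_cst.
  - move=> s s0; apply: is_derive_eq.
      exact: (is_deriveM (Dq s s0) (is_derive_expRM (- b) s)).
    by rewrite /GRing.scale /=; ring.
  - by move=> s s0; rewrite mulr_ge0_le0 ?expR_ge0// subr_le0 dqb.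
  - by rewrite /p mulr0 expR0 mulr1.
move: H; rewrite mulr0 expR0 mulr1 subrr add0r mulNr expRN.
by rewrite ler_pdivrMr ?expR_gt0.
Qed.

Lemma is_derive_sumr (R : realType) (I : finType) (h : I -> R -> R)
    (dh : I -> R) (t : R) :
  (forall k, is_derive t (1 : R) (h k) (dh k)) ->
  is_derive t (1 : R) (fun s => \sum_k h k s) (\sum_k dh k).
Proof.
move=> Dh.
have -> : (fun s => \sum_k h k s) = \sum_k h k.
  by apply/funext => s; rewrite fct_sumE.
by elim/big_ind2 : _ => // [|] *; [exact: is_derive_cst|exact: is_deriveD].
Qed.

Lemma continuous_sumr (R : realType) (I : finType) (h : I -> R -> R) :
  (forall k, continuous (h k)) -> continuous (fun s => \sum_k h k s).
Proof.
move=> ch.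
have -> : (fun s => \sum_k h k s) = \sum_k h k.
  by apply/funext => s; rewrite fct_sumE.
by elim/big_ind : _ => // [|f g cf cg] s;
  [exact: cvg_cst|apply: cvgD; [exact: cf|exact: cg]].
Qed.

(** Only t >= 0 matters, and the even extension keeps [G] continuous on the whole line without a
    one-sided argument at 0. *)
Lemma continuous_antiderivative (R : realType) (f : R -> R) (c : R) :
  continuous f ->
  exists G : R -> R,
    [/\ G 0 = c, continuous G, (forall t : R, G `|t| = G t)
      & forall t : R, 0 < t -> is_derive t (1 : R) G (f t)].
Proof.
move=> cf.
pose mu : measure _ _ := @lebesgue_measure R.
(* Integrating from -1 makes 0 an interior point, so that the primitive is differentiable there. *)
pose P y := (\int[mu]_(t in `[(-1 : R), y]) f t)%R.
have DP (t : R) : -1 < t -> is_derive t (1 : R) P (f t).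
  move=> t1.
  have [|||dP eP] := @continuous_FTC1_closed R f (-1) t (t + 1) _ _ t1.
  - by rewrite ltrDl.
  - apply: continuous_compact_integrable; first exact: segment_compact.
    exact: continuous_subspaceT.
  - exact: cf.
  - by apply: DeriveDef; [exact: dP|rewrite -derive1E; exact: eP].
have cP (t : R) : 0 <= t -> {for t, continuous P}.
  move=> t0; apply/differentiable_continuous/derivable1_diffP.
  by have /DP H : -1 < t by lra.
exists (fun t => c - P 0 + P `|t|); split.
- by rewrite normr0; ring.
- move=> t; apply: cvgD; first exact: cvg_cst.
  apply: (@continuous_comp _ _ _ (fun t : R => `|t|) P).
    exact: norm_continuous.
  exact: cP.
- by move=> t; rewrite normr_id.
- move=> t t0.
  have D1 : is_derive t (1 : R) (cst (c - P 0) + P) (0 + f t).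
    have /DP H : -1 < t by lra.
    exact: is_deriveD.
  rewrite add0r in D1.
  apply: (near_eq_is_derive _ D1).
  near=> s; rewrite /= !fctE gtr0_norm//; near: s.
  exact: lt_nbhsr.
Unshelve. all: by end_near. Qed.

(** * Geometric convergence and continuity *)

Lemma geometric_lt (R : realType) (A q e : R) :
  0 <= q < 1 -> 0 < e -> exists n, A * q ^+ n < e.
Proof.
move=> /andP[q0 q1] e0.
have cq : `|q| < 1 by rewrite ger0_norm.
have : A * q ^+ n @[n --> \oo] --> A * 0 by apply: cvgMr; exact: cvg_expr.
rewrite mulr0 => /cvgrPdist_lt /(_ _ e0)[n _ /(_ n (leqnn n))].
rewrite sub0r normrN => H; exists n; exact: le_lt_trans (ler_norm _) H.
Qed.

Lemma le_geometric_eq0 (R : realType) (A q x : R) :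
  0 <= q < 1 -> (forall n, `|x| <= A * q ^+ n) -> x = 0.
Proof.
move=> q01 H; apply: contrapT => /eqP; rewrite -normr_gt0 => x0.
by have [n] := geometric_lt A q01 x0; rewrite ltNge H.
Qed.

(* The sequences [u n -+ A q^n / (1 - q)] are monotone and enclose the limit. *)
Lemma geometric_cauchy (R : realType) (u : nat -> R) (A q : R) :
  0 <= q < 1 -> (forall n, `|u n.+1 - u n| <= A * q ^+ n) ->
  exists l, forall n, `|u n - l| <= A / (1 - q) * q ^+ n.
Proof.
move=> /andP[q0 q1] H.
have p0 : 0 < 1 - q by rewrite subr_gt0.
pose r n := A / (1 - q) * q ^+ n.
have rS n : r n - r n.+1 = A * q ^+ n.
  by rewrite /r exprS; field; rewrite gt_eqF.
have r0 n : 0 <= r n.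
  rewrite /r -mulrA [X in A * X]mulrC mulrA divr_ge0 ?(ltW p0)//.
  exact: le_trans (H n).
have wS : {homo (fun n => u n - r n) : n m / (n <= m)%N >-> n <= m}.
  apply: homo_leq => //; first exact: le_trans.
  by move=> n; move: (H n) (rS n); rewrite ler_norml => /andP[]; lra.
have vS : {homo (fun n => u n + r n) : n m / (n <= m)%N >-> m <= n}.
  apply: (@homo_leq _ _ (fun x y => y <= x)) => //.
    by move=> y x z xy yz; exact: le_trans yz xy.
  by move=> n; move: (H n) (rS n); rewrite ler_norml => /andP[]; lra.
have wv n m : u n - r n <= u m + r m.
  have H1 := wS _ _ (leq_maxl n m); have H2 := vS _ _ (leq_maxr n m).
  by have := r0 (maxn n m); lra.
pose E := range (fun n => u n - r n).
have sE : has_sup E.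
  split; first by exists (u 0%N - r 0%N), 0%N.
  by exists (u 0%N + r 0%N) => _ [n _ <-].
exists (sup E) => n; rewrite -/(r n) ler_norml; apply/andP; split.
  suff : sup E <= u n + r n by lra.
  apply: ge_sup; first by case: sE.
  by move=> _ [m _ <-].
suff : u n - r n <= sup E by lra.
apply: ub_le_sup; first by case: sE.
by exists n.
Qed.

Lemma geometric_limit_continuous (R : realType) (X : nat -> R -> R)
    (Z A : R -> R) (q : R) :
  0 <= q < 1 -> continuous A -> (forall n, continuous (X n)) ->
  (forall n t, `|X n t - Z t| <= A t * q ^+ n) -> continuous Z.
Proof.
move=> q01 cA cX H t; apply/cvgrPdist_lt => e e0.
have e3 : 0 < e / 3 by rewrite divr_gt0.
(* Near [t] the continuous factor [A] stays below [A t + 1], so one [n] makes the error small at [t]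
   and at all nearby points. *)
have [n Hn] := geometric_lt (A t + 1) q01 e3.
have qn0 : 0 <= q ^+ n by rewrite exprn_ge0//; case/andP: q01.
have Hs (s : R) : A s < A t + 1 -> `|X n s - Z s| < e / 3.
  move=> As; apply: le_lt_trans (H n s) _; apply: le_lt_trans Hn.
  by rewrite ler_wpM2r// ltW.
have At := Hs t; rewrite ltrDl in At; have {}At := At ltr01.
near=> s.
have Xs : `|X n t - X n s| < e / 3.
  near: s; have /cvgrPdist_lt := cX n t; exact.
have As : A s < A t + 1.
  suff : `|A t - A s| < 1 by rewrite ltr_norml => /andP[]; lra.
  near: s; have /cvgrPdist_lt := cA t; exact.
have {}As := Hs _ As.
have -> : Z t - Z s = (X n s - Z s) - (X n t - Z t) + (X n t - X n s) by ring.
apply: le_lt_trans (ler_normD _ _) _.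
by have := ler_normB (X n s - Z s) (X n t - Z t); lra.
Unshelve. all: by end_near. Qed.

(** The bound $L\sum_k|z_k(t)-z_k(s)|$ is continuous in s and vanishes at s = t. *)
Lemma lipschitz_continuous_comp (R : realType) (I : finType) (L : R)
    (f : (I -> R) -> R) (z : R -> I -> R) :
  (forall v w, `|f v - f w| <= L * \sum_k `|v k - w k|) ->
  (forall k, continuous (fun t => z t k)) -> continuous (fun t => f (z t)).
Proof.
move=> fL cz t; apply/cvgrPdist_le => e e0.
have : continuous (fun s => L * \sum_k `|z t k - z s k|).
  move=> s; apply: cvgMr; apply: continuous_sumr => k {}s.
  apply: cvg_norm; apply: cvgB; first exact: cvg_cst.
  exact: cz.
move=> /(_ t) /cvgrPdist_le /(_ _ e0) H.
near=> s; apply: le_trans (fL _ _) _.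
have : `|L * (\sum_k `|z t k - z t k|) - L * (\sum_k `|z t k - z s k|)| <= e.
  near: s; exact: H.
rewrite [X in L * X - _]big1; last by move=> k _; rewrite subrr normr0.
by rewrite mulr0 sub0r normrN; apply: le_trans (ler_norm _).
Unshelve. all: by end_near. Qed.

(** * Equations z' = B z - K z with B Lipschitz in l1 *)

(* Solutions on t > 0, extended continuously (in practice evenly) to t <= 0 so
   that one-sided continuity at 0 never has to be handled. *)
Definition forward_solution (R : realType) (I : finType)
    (F : (I -> R) -> I -> R) (z : R -> I -> R) : Prop :=
  (forall k, continuous (fun t => z t k)) /\
  (forall t : R, 0 < t ->
     forall k, is_derive t (1 : R) (fun s => z s k) (F (z t) k)).

(** Composing with the absolute value discards the values at negative times; the right limit at 0
    then becomes a two-sided one. *)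
Lemma forward_solution_normr (R : realType) (I : finType)
    (F : (I -> R) -> I -> R) (z : R -> I -> R) :
  (forall k, z t k @[t --> 0^'+] --> z 0 k) ->
  (forall t : R, 0 < t ->
     forall k, is_derive t (1 : R) (fun s => z s k) (F (z t) k)) ->
  forward_solution F (fun t => z `|t|).
Proof.
move=> c0 Dz; split=> [k t|t t0 k].
- have [->|t0] := eqVneq t 0.
    apply/cvgrPdist_lt => e e0.
    have /cvgrPdist_lt /(_ _ e0) [d /= d0 H] := c0 k.
    near=> s; rewrite normr0.
    have [->|s0] := eqVneq s 0; first by rewrite normr0 subrr normr0.
    apply: H; last by rewrite /= normr_gt0.
    rewrite /ball_ /= sub0r normrN normr_id.
    near: s; have /nbhs_normP := nbhsx_ballx (0 : R) d d0.
    by case=> d' d'0 H; exists d' => // s /H; rewrite /ball /= sub0r normrN.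
  apply: (@continuous_comp _ _ _ (fun s : R => `|s|) (fun s => z s k)).
    exact: norm_continuous.
  apply/differentiable_continuous/derivable1_diffP.
  have /Dz /(_ k) H : 0 < `|t| by rewrite normr_gt0.
  exact: ex_derive.
- rewrite gtr0_norm//; apply: (near_eq_is_derive _ (Dz t t0 k)).
  near=> s; rewrite gtr0_norm//; near: s; exact: lt_nbhsr.
Unshelve. all: by end_near. Qed.

Lemma l1_contraction (R : realType) (I : finType) (B : (I -> R) -> I -> R)
    (b K : R) (z w : R -> I -> R) :
  0 <= b ->
  (forall v v', \sum_k `|B v k - B v' k| <= b * \sum_k `|v k - v' k|) ->
  forward_solution (fun v k => B v k - K * v k) z ->
  forward_solution (fun v k => B v k - K * v k) w ->
  forall t : R, 0 <= t ->
    \sum_k `|z t k - w t k| <= (\sum_k `|z 0 k - w 0 k|) * expR ((b - K) * t).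
Proof.
move=> b0 Bb [cz Dz] [cw Dw] t t0.
have cB k v : (forall k, continuous (fun t => v t k)) ->
    continuous (fun t : R => B (v t) k).
  move=> cv; apply: (@lipschitz_continuous_comp R I b (B^~ k)) => // u u'.
  by apply: le_trans (Bb u u'); exact: norm_le_sum.
(* The factor $e^{Ks}$ removes the damping: [u k] has derivative [g k], and $\sum_k|g_k|\le
   b\sum_k|u_k|$. *)
pose u k s := expR (K * s) * (z s k - w s k).
pose g k s := expR (K * s) * (B (z s) k - B (w s) k).
have cu k : continuous (u k).
  move=> s; apply: cvgM; first exact: continuous_expRM.
  by apply: cvgB; [exact: cz|exact: cw].
have cg k : continuous (fun s => `|g k s|).
  move=> s; apply: cvg_norm; apply: cvgM; first exact: continuous_expRM.
  by apply: cvgB; exact: cB.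
have Du (s : R) k : 0 < s -> is_derive s (1 : R) (u k) (g k s).
  move=> s0; apply: is_derive_eq.
    exact: (is_deriveM (is_derive_expRM K s)
      (is_deriveB (Dz _ s0 k) (Dw _ s0 k))).
  by rewrite !fctE /g /GRing.scale /=; ring.
(* The absolute value of [u k] need not be differentiable, so Gronwall's lemma is applied to the sum
   of majorants [H k], whose derivatives are the absolute values of the [g k]. *)
have /choice [H HP] : forall k, exists H : R -> R,
    [/\ H 0 = `|u k 0|, continuous H &
        forall s : R, 0 < s -> is_derive s (1 : R) H `|g k s|].
  move=> k; have [G [G0 cG _ DG]] := continuous_antiderivative `|u k 0| (cg k).
  by exists G.
have uH k (s : R) : 0 <= s -> `|u k s| <= H k s.
  have [H0 cH DH] := HP k.
  apply: (@is_derive_norm_le _ (u k) (H k) (g k) (fun s => `|g k s|)) => //.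
  by rewrite H0.
pose Q s := \sum_k H k s.
have QE : Q t <= Q 0 * expR (b * t).
  apply: (@is_derive_gronwall _ Q (fun s => \sum_k `|g k s|)) => //.
  - by apply: continuous_sumr => k; have [] := HP k.
  - by move=> s s0; apply: is_derive_sumr => k; have [_ _] := HP k; exact.
  - move=> s s0; apply: (@le_trans _ _ (b * \sum_k `|u k s|)).
      rewrite (eq_bigr (fun k => expR (K * s) * `|B (z s) k - B (w s) k|));
        last by move=> k _; rewrite /g normrM ger0_norm ?expR_ge0.
      rewrite -mulr_sumr.
      rewrite [in leRHS](eq_bigr (fun k => expR (K * s) * `|z s k - w s k|));
        last by move=> k _; rewrite /u normrM ger0_norm ?expR_ge0.
      rewrite -mulr_sumr mulrCA ler_wpM2l ?expR_ge0//.
    rewrite ler_wpM2l//; apply: ler_sum => k _; apply: uH; exact: ltW.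
have Q0 : Q 0 = \sum_k `|z 0 k - w 0 k|.
  apply: eq_bigr => k _; have [-> _ _] := HP k.
  by rewrite /u mulr0 expR0 mul1r.
have : expR (K * t) * \sum_k `|z t k - w t k| <= Q 0 * expR (b * t).
  apply: le_trans QE; rewrite mulr_sumr; apply: ler_sum => k _.
  by apply: le_trans (uH k t t0); rewrite /u normrM ger0_norm ?expR_ge0.
rewrite -ler_pdivlMl ?expR_gt0// => /le_trans; apply.
rewrite Q0 -expRN mulrCA -expRD.
by have -> : - (K * t) + b * t = (b - K) * t by ring.
Qed.

(** Banach's fixed point theorem for $v\mapsto Bv/K$ in l1, the limit being taken coordinate by
    coordinate. *)
Lemma l1_contraction_fixpoint (R : realType) (I : finType)
    (B : (I -> R) -> I -> R) (b K : R) :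
  0 <= b < K ->
  (forall v v', \sum_k `|B v k - B v' k| <= b * \sum_k `|v k - v' k|) ->
  exists2 v, forall k, B v k = K * v k &
    forall v', (forall k, B v' k = K * v' k) -> v' = v.
Proof.
move=> /andP[b0 bK] Bb.
have K0 : 0 < K by exact: le_lt_trans bK.
have q01 : 0 <= b / K < 1 by rewrite divr_ge0 ?(ltW K0)//= ltr_pdivrMr ?mul1r.
have Buniq v v' : (forall k, B v k = K * v k) ->
    (forall k, B v' k = K * v' k) -> v' = v.
  move=> Bv Bv'; pose S := \sum_k `|v' k - v k|.
  have SK : K * S <= b * S.
    apply: le_trans (Bb v' v); rewrite mulr_sumr ler_sum// => k _.
    by rewrite Bv Bv' -mulrBr normrM (gtr0_norm K0).
  have S0 : 0 <= S by exact: sumr_ge0.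
  have {S0 SK}S0 : S <= 0.
    by rewrite leNgt; apply/negP => S0'; nra.
  by apply/funext => k; apply/eqP; rewrite -subr_eq0 (sum_norm_eq0 S0 k).
pose w := fix w n := if n is m.+1
  then (fun k => B (w m) k / K) else cst (0 : R).
pose A := \sum_k `|w 1%N k - w 0%N k|.
have wS n : \sum_k `|w n.+1 k - w n k| <= A * (b / K) ^+ n.
  elim: n => [|n IH]; first by rewrite expr0 mulr1; exact: lexx.
  have -> : \sum_k `|w n.+2 k - w n.+1 k| =
            (\sum_k `|B (w n.+1) k - B (w n) k|) / K.
    rewrite mulr_suml; apply: eq_bigr => k _.
    by rewrite -mulrBl normrM normfV (gtr0_norm K0).
  rewrite ler_pdivrMr//; apply: le_trans (Bb _ _) _.
  have -> : A * (b / K) ^+ n.+1 * K = b * (A * (b / K) ^+ n).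
    by rewrite exprS; field; rewrite gt_eqF.
  exact: ler_wpM2l.
have /choice [v vP] : forall k, exists l, forall n,
    `|w n k - l| <= A / (1 - b / K) * (b / K) ^+ n.
  move=> k; apply: geometric_cauchy => // n; apply: le_trans (wS n).
  exact: norm_le_sum.
suff Bv : forall k, B v k = K * v k.
  by exists v => // v' Bv'; exact: Buniq.
(* The residual is independent of [n]; since $Bw_n=Kw_{n+1}$, it splits into two errors of order
   $(b/K)^n$. *)
move=> k; apply/eqP; rewrite -subr_eq0; apply/eqP.
apply: (@le_geometric_eq0 _ (b * \sum_(j : I) (A / (1 - b / K)) +
  K * (A / (1 - b / K))) (b / K)) => // n.
have -> : B v k - K * v k = (B v k - B (w n) k) + K * (w n.+1 k - v k).
  by rewrite /=; field; rewrite gt_eqF.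
apply: le_trans (ler_normD _ _) _; rewrite mulrDl lerD//.
  apply: (@le_trans _ _ (\sum_k `|B v k - B (w n) k|)).
    exact: norm_le_sum.
  apply: le_trans (Bb _ _) _; rewrite -mulrA ler_wpM2l// mulr_suml.
  by apply: ler_sum => j _; rewrite distrC.
rewrite normrM (gtr0_norm K0) -mulrA ler_pM2l//.
apply: le_trans (vP k n.+1) _; rewrite ler_wpM2l//.
  rewrite divr_ge0 ?sumr_ge0// subr_ge0.
  by case/andP: q01 => _ /ltW.
by case/andP: q01 => q0 q1; rewrite exprS ler_piMl ?exprn_ge0// ltW.
Qed.

(* Picard iterates, with successive differences at most
   [M 2^-n exp (C |t|)] where [C] exceeds twice the sup-norm
   Lipschitz constant. *)
Lemma picard_existence (R : realType) (I : finType) (F : (I -> R) -> I -> R)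
    (L : R) (c : I -> R) :
  0 <= L ->
  (forall k v w, `|F v k - F w k| <= L * \sum_j `|v j - w j|) ->
  exists2 z, forward_solution F z & z 0 = c.
Proof.
move=> L0 FL.
have cF k z : (forall j, continuous (fun t => z t j)) ->
    continuous (fun t : R => F (z t) k).
  by move=> cz; apply: (@lipschitz_continuous_comp R I L (F^~ k)).
(* A total choice of antiderivative, with default 0 for discontinuous integrands, allows the
   iterates to be defined before they are known to be continuous. *)
have /choice [P PP] : forall fa : (R -> R) * R, exists G : R -> R,
    continuous fa.1 ->
    [/\ G 0 = fa.2, continuous G, (forall t : R, G `|t| = G t)
      & forall t : R, 0 < t -> is_derive t (1 : R) G (fa.1 t)].
  move=> [f a] /=; have [/(continuous_antiderivative a) [G GP]|nc] :=
    pselect (continuous f); first by exists G.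
  by exists (fun=> 0) => /nc.
pose X := fix X n := if n is m.+1
  then (fun (t : R) k => P (fun s => F (X m s) k, c k) t) else (fun _ => c).
have cX n k : continuous (fun t => X n t k).
  elim: n k => [|n IH] k; first by move=> t; exact: cvg_cst.
  by have [] := PP (fun s => F (X n s) k, c k) (cF k _ IH).
have XS n k := PP (fun s => F (X n s) k, c k) (cF k _ (cX n)).
have X0 n k : X n 0 k = c k by case: n => [//|n]; have [] := XS n k.
have Xe n t k : X n `|t| k = X n t k.
  by case: n => [//|n]; have [_ _ + _] := XS n k; exact.
pose m : R := #|I|%:R.
have m0 : 0 <= m by rewrite ler0n.
have FLm k v w a : (forall j, `|v j - w j| <= a) ->
    `|F v k - F w k| <= L * m * a.
  move=> H; apply: le_trans (FL k v w) _; rewrite -mulrA ler_wpM2l//.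
  by rewrite /m mulr_natl -sumr_const ler_sum.
(* The factor 2 gives $C D_{n+1}=(Lm+1)D_n$, hence the ratio 1/2; the added 1 keeps [C] at least 1,
   which the bound on the first increment uses. *)
pose C := 2 * (L * m + 1).
have Lm0 : 0 <= L * m by rewrite mulr_ge0.
have C1 : 1 <= C by rewrite /C; lra.
pose M := \sum_k `|F c k|.
have M0 : 0 <= M by exact: sumr_ge0.
pose D n (t : R) := M * 2^-1 ^+ n * expR (C * t).
have D0 n t : 0 <= D n t by rewrite !mulr_ge0 ?expR_ge0 ?exprn_ge0.
have cD n : continuous (D n).
  by move=> t; apply: cvgMr; exact: continuous_expRM.
have dD n (t : R) : is_derive t (1 : R) (D n) (C * D n t).
  have H := is_deriveZ (M * 2^-1 ^+ n) (is_derive_expRM C t).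
  by rewrite /D mulrCA; exact: H.
have XD n k (t : R) : 0 <= t -> `|X n.+1 t k - X n t k| <= D n t.
  elim: n k t => [|n IH] k t t0.
    have [_ c1 _ D1] := XS 0%N k.
    apply: (@is_derive_norm_le _ (fun t => X 1%N t k - c k) (D 0%N)
      (fun=> F c k - 0) (fun t => C * D 0%N t)) => //.
    - by move=> s; apply: cvgB; [exact: c1|exact: cvg_cst].
    - move=> s s0; exact: (is_deriveB (D1 s s0) (is_derive_cst (c k) s 1)).
    - move=> s s0; rewrite subr0 /D expr0 mulr1 mulrCA.
      have F0 : `|F c k| <= M by rewrite /M (bigD1 k)//= lerDl sumr_ge0.
      apply: (le_trans F0); rewrite ler_peMr// -[leLHS]mulr1 ler_pM//.
      rewrite -expR0 ler_expR mulr_ge0//; [lra|exact: ltW].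
    - by rewrite X0 subrr normr0.
  have [_ c1 _ D1] := XS n.+1 k; have [_ c2 _ D2] := XS n k.
  apply: (@is_derive_norm_le _ (fun t => X n.+2 t k - X n.+1 t k) (D n.+1)
    (fun t => F (X n.+1 t) k - F (X n t) k) (fun t => C * D n.+1 t)) => //.
  - by move=> s; apply: cvgB; [exact: c1|exact: c2].
  - move=> s s0; exact: (is_deriveB (D1 s s0) (D2 s s0)).
  - move=> s s0; apply: le_trans (FLm k _ _ (D n s) _) _.
      by move=> j; exact: IH (ltW s0).
    have -> : C * D n.+1 s = (L * m + 1) * D n s.
      by rewrite /C /D exprS; field.
    by rewrite ler_wpM2r// lerDl.
  - by rewrite !X0 subrr normr0.
have q01 : 0 <= (2^-1 : R) < 1 by apply/andP; split; lra.
(* The bound for the geometric tail; the absolute value of [t] covers negative times because the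
   iterates are even. *)
pose A (t : R) := M * expR (C * `|t|) / (1 - 2^-1).
have /choice [Z ZP] : forall tk : R * I, exists l, forall n,
    `|X n tk.1 tk.2 - l| <= A tk.1 * 2^-1 ^+ n.
  move=> [t k] /=; apply: geometric_cauchy => // n.
  by rewrite -!(Xe _ t) mulrAC; exact: XD.
have cZ k : continuous (fun t => Z (t, k)).
  apply: (@geometric_limit_continuous _ (fun n t => X n t k) _ A _ q01) => //.
    move=> t; apply: cvgMl; apply: cvgMr.
    apply: (@continuous_comp _ _ _ (fun s : R => `|s|) (fun s => expR (C * s))).
      exact: norm_continuous.
    exact: continuous_expRM.
  by move=> n t; exact: (ZP (t, k)).
(* The limit [Z] is only known to be continuous. The antiderivative [z] of [F] along [Z] is
   differentiable for t > 0 by construction and is then shown to equal [Z] for t >= 0, so no limit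
   is exchanged with a derivative. *)
pose z t k := P (fun s => F (fun j => Z (s, j)) k, c k) t.
have zP k := PP (fun s => F (fun j => Z (s, j)) k, c k)
  (cF k (fun s j => Z (s, j)) cZ).
have XZ n k (t : R) : 0 <= t -> `|X n.+1 t k - z t k| <= D n t.
  have [_ c1 _ D1] := XS n k; have [z0 c2 _ D2] := zP k.
  apply: (@is_derive_norm_le _ (fun t => X n.+1 t k - z t k) (D n)
    (fun t => F (X n t) k - F (fun j => Z (t, j)) k)
    (fun t => C * D n t)) => //.
  - by move=> s; apply: cvgB; [exact: c1|exact: c2].
  - move=> s s0; exact: (is_deriveB (D1 s s0) (D2 s s0)).
  (* The 2 is $1/(1-1/2)$: [Z] is within [2 * D n s] of the iterate [X n]. *)
  - move=> s s0; apply: le_trans (FLm k _ _ (2 * D n s) _) _.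
      move=> j; apply: le_trans (ZP (s, j) n) _.
      rewrite /A /D /= (gtr0_norm s0).
      by rewrite [leLHS](_ : _ = 2 * (M * 2^-1 ^+ n * expR (C * s)))//; field.
    have -> : C * D n s = (L * m) * (2 * D n s) + 2 * D n s.
      by rewrite /C; ring.
    by rewrite lerDl mulr_ge0.
  - by rewrite X0 /z z0 subrr normr0.
have Zz (t : R) : 0 <= t -> (fun j => Z (t, j)) = z t.
  move=> t0; apply/funext => k; apply/eqP; rewrite -subr_eq0; apply/eqP.
  apply: (@le_geometric_eq0 _ (A t + M * expR (C * t)) 2^-1) => // n.
  have -> : Z (t, k) - z t k = (X n.+1 t k - z t k) - (X n.+1 t k - Z (t, k)).
    by ring.
  apply: le_trans (ler_normB _ _) _; rewrite mulrDl addrC lerD//.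
    apply: le_trans (ZP (t, k) n.+1) _ => /=.
    rewrite exprS ler_wpM2l//; last by rewrite ler_piMl ?exprn_ge0//; lra.
    by rewrite /A divr_ge0 ?mulr_ge0 ?expR_ge0//; lra.
  by apply: le_trans (XZ n k t t0) _; rewrite /D mulrAC.
exists z; last by apply/funext => k; have [] := zP k.
split=> [k|t t0 k]; first by have [] := zP k.
by rewrite -Zz ?ltW//; have [_ _ _] := zP k; exact.
Qed.

(** * The system with minima *)

(** The function $f(t)e^{Kt}$ is nondecreasing, so it stays at least [f 0]. *)
Lemma is_derive_gt0 (R : realType) (f df : R -> R) (K : R) :
  continuous f ->
  (forall t : R, 0 < t -> is_derive t (1 : R) f (df t)) ->
  (forall t : R, 0 < t -> - K * f t <= df t) -> 0 < f 0 ->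
  forall t : R, 0 <= t -> 0 < f t.
Proof.
move=> cf Df dfK f0 t t0.
suff : f 0 * expR (K * 0) <= f t * expR (K * t).
  rewrite mulr0 expR0 mulr1 => /(lt_le_trans f0).
  by rewrite pmulr_lgt0 ?expR_gt0.
apply: (@is_derive_nondecreasing _ (fun t => f t * expR (K * t))
  (fun t => expR (K * t) * (df t + K * f t))) => //.
- by move=> s; apply: cvgM; [exact: cf|exact: continuous_expRM].
- move=> s s0; apply: is_derive_eq.
    exact: (is_deriveM (Df s s0) (is_derive_expRM K s)).
  by rewrite /GRing.scale /=; ring.
- move=> s s0; rewrite mulr_ge0 ?expR_ge0//.
  by have := dfK s s0; rewrite mulNr; lra.
Qed.

(** The two excesses are the positive and negative parts of $x-y$. Together these vary by exactly
    $|(x-y)-(x'-y')|$, which the triangle inequality bounds. *)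
Lemma min_excess_contraction (R : realDomainType) (x y x' y' : R) :
  `|(x - Num.min x y) - (x' - Num.min x' y')| +
  `|(y - Num.min x y) - (y' - Num.min x' y')| <= `|x - x'| + `|y - y'|.
Proof.
have hx := ler_norm (x - x'); have hx' := ler_norm (- (x - x')).
have hy := ler_norm (y - y'); have hy' := ler_norm (- (y - y')).
rewrite !normrN in hx' hy'.
case: (lerP x y) => xy; case: (lerP x' y') => xy'; rewrite !subrr ?subr0 ?sub0r.
- by rewrite normr0 add0r ler_norml; apply/andP; split; lra.
- rewrite normrN (@ger0_norm _ (x' - y')) ?(@ger0_norm _ (y - x)); lra.
- rewrite normrN (@ger0_norm _ (x - y)) ?(@ger0_norm _ (y' - x')); lra.
- by rewrite normr0 addr0 ler_norml; apply/andP; split; lra.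
Qed.

(** Indexing all coordinates by one finite type makes the general results on $z'=Bz-Kz$ applicable,
    with a single l1 norm for the pair (x, y). *)
Definition queue_state (R : realType) (n : nat) (x y : 'rV[R]_n)
    (k : 'I_n + 'I_n) : R :=
  match k with inl i => x 0 i | inr i => y 0 i end.

(* The right-hand side of the system plus [(alphaQ + alphaM + gamma)] times the
   state: adding [gamma] turns [- gamma * min] into the nonnegative excess
   [gamma * (x - min)]. *)
Definition queue_inflow (R : realType) (n : nat)
    (gamma alphaM lambdab lambdas : R) (v : 'I_n.+1 + 'I_n.+1 -> R)
    (k : 'I_n.+1 + 'I_n.+1) : R :=
  match k with
  | inl i => (if i == ord0 then lambdab else alphaM * v (inl (inord i.-1))) +
      gamma * (v (inl i) - Num.min (v (inl i)) (v (inr i)))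
  | inr i => (if i == ord_max then lambdas else alphaM * v (inr (inord i.+1))) +
      gamma * (v (inr i) - Num.min (v (inl i)) (v (inr i)))
  end.

(** Neighbours are named by [inord], which returns the intended index only within range; hence the
    excluded end, here and for successors. *)
Lemma inord_pred_succ (n : nat) (i : 'I_n.+1) :
  i != ord0 -> i = (inord i.-1 : 'I_n.+1).+1 :> nat.
Proof.
rewrite -val_eqE /= -lt0n => i0.
by rewrite inordK ?prednK//; exact: ltnW (ltn_ord i).
Qed.

Lemma inord_succ_max (n : nat) (i : 'I_n.+1) :
  i != ord_max -> (inord i.+1 : 'I_n.+1) = i.+1 :> nat.
Proof.
rewrite -val_eqE /= => im; rewrite inordK// ltnS ltn_neqAle im /= -ltnS.
exact: ltn_ord.
Qed.

(** The shift reindexes the sum and loses only the last term, which is nonnegative; the opposite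
    shift loses the first one. *)
Lemma sum_ord_shift_down (R : realType) (n : nat) (f : 'I_n.+1 -> R) :
  (forall i, 0 <= f i) ->
  \sum_(i < n.+1) (if i == ord0 then 0 else f (inord i.-1)) <= \sum_i f i.
Proof.
move=> f0; rewrite big_ord_recl eqxx add0r big_ord_recr /=.
rewrite (eq_bigr (fun i => f (widen_ord (leqnSn n) i))); first by rewrite lerDl.
move=> i _ /=; congr f; apply/val_inj; rewrite /= inordK //.
exact: ltnW (ltn_ord i).
Qed.

Lemma sum_ord_shift_up (R : realType) (n : nat) (f : 'I_n.+1 -> R) :
  (forall i, 0 <= f i) ->
  \sum_(i < n.+1) (if i == ord_max then 0 else f (inord i.+1)) <= \sum_i f i.
Proof.
move=> f0; rewrite big_ord_recr /= eqxx addr0 big_ord_recl.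
rewrite (eq_bigr (fun i => f (lift ord0 i))); first by rewrite lerDr.
move=> i _; rewrite -val_eqE /= ltn_eqF//; congr f; apply/val_inj.
by rewrite /= inordK // ltnS.
Qed.

(** The sources [lambdab] and [lambdas] cancel in the difference, and each shift acts within its own
    half. The excess of x depends on y as well, so the two excesses are bounded only together, index
    by index. *)
Lemma queue_inflow_contraction (R : realType) (n : nat)
    (gamma alphaM lambdab lambdas : R) (v w : 'I_n.+1 + 'I_n.+1 -> R) :
  0 <= gamma -> 0 <= alphaM ->
  \sum_k `|queue_inflow gamma alphaM lambdab lambdas v k -
           queue_inflow gamma alphaM lambdab lambdas w k|
  <= (alphaM + gamma) * \sum_k `|v k - w k|.
Proof.
move=> g0 a0; rewrite !big_sumType /=.
pose dx i := `|v (inl i) - w (inl i)|; pose dy i := `|v (inr i) - w (inr i)|.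
pose ex (i : 'I_n.+1) := `|(v (inl i) - Num.min (v (inl i)) (v (inr i))) -
  (w (inl i) - Num.min (w (inl i)) (w (inr i)))|.
pose ey (i : 'I_n.+1) := `|(v (inr i) - Num.min (v (inl i)) (v (inr i))) -
  (w (inr i) - Num.min (w (inl i)) (w (inr i)))|.
have exy : \sum_i ex i + \sum_i ey i <= \sum_i dx i + \sum_i dy i.
  rewrite -!big_split /=; apply: ler_sum => i _; exact: min_excess_contraction.
have sx := @sum_ord_shift_down R n dx (fun _ => normr_ge0 _).
have sy := @sum_ord_shift_up R n dy (fun _ => normr_ge0 _).
have -> : (alphaM + gamma) * (\sum_i dx i + \sum_i dy i) =
    alphaM * \sum_i dx i + alphaM * \sum_i dy i +
    gamma * (\sum_i dx i + \sum_i dy i) by ring.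
apply: le_trans (lerD (lerD (ler_wpM2l a0 sx) (ler_wpM2l a0 sy))
  (ler_wpM2l g0 exy)).
rewrite mulrDr addrACA; apply: lerD; rewrite !mulr_sumr -big_split /=;
  apply: ler_sum => i _.
- have -> : forall p q r s, p + gamma * q - (r + gamma * s) =
    (p - r) + gamma * (q - s) :> R by move=> *; ring.
  apply: le_trans (ler_normD _ _) _; apply: lerD.
    by case: ifP => _; rewrite ?subrr ?normr0 ?mulr0// -mulrBr normrM ger0_norm.
  by rewrite normrM ger0_norm.
- have -> : forall p q r s, p + gamma * q - (r + gamma * s) =
    (p - r) + gamma * (q - s) :> R by move=> *; ring.
  apply: le_trans (ler_normD _ _) _; apply: lerD.
    by case: ifP => _; rewrite ?subrr ?normr0 ?mulr0// -mulrBr normrM ger0_norm.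
  by rewrite normrM ger0_norm.
Qed.

(** * Translation of the system and positivity of its solutions *)

Lemma ode_atP (R : realType) (n : nat)
    (gamma alphaQ alphaM lambdab lambdas : R) (x y : R -> 'rV[R]_n.+1) (t : R) :
  ode_at gamma alphaQ alphaM lambdab lambdas x y t <->
  forall k, is_derive t (1 : R) (fun s => queue_state (x s) (y s) k)
    (queue_inflow gamma alphaM lambdab lambdas (queue_state (x t) (y t)) k -
     (alphaQ + alphaM + gamma) * queue_state (x t) (y t) k).
Proof.
split=> [[H1 H2 H3 H4] [i|i] /=|H].
- have [i0|i0] := eqVneq i ord0.
    by apply: is_derive_eq (H1 i _) _; [rewrite i0|ring].
  by apply: is_derive_eq (H2 i _ (inord_pred_succ i0)) _; ring.
- have [im|im] := eqVneq i ord_max.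
    by apply: is_derive_eq (H4 i _) _; [rewrite im|ring].
  by apply: is_derive_eq (H3 i _ (inord_succ_max im)) _; ring.
- split=> [i i0|i j ij|i j ij|i im].
  + have := H (inl i) => /= Hi; apply: is_derive_eq Hi _.
    by rewrite -val_eqE /= i0 eqxx; ring.
  + have := H (inl i) => /= Hi; apply: is_derive_eq Hi _.
    by rewrite -val_eqE /= ij /= inord_val; ring.
  + have := H (inr i) => /= Hi; apply: is_derive_eq Hi _.
    have /ltn_eqF i1 : (i < n)%N by rewrite -ltnS -ij ltn_ord.
    by rewrite -val_eqE /= i1 -ij inord_val; ring.
  + have := H (inr i) => /= Hi; apply: is_derive_eq Hi _.
    by case: im => im; rewrite -val_eqE /= im eqxx; ring.
Qed.

Lemma fixed_point_systemP (R : realType) (n : nat)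
    (gamma alphaQ alphaM lambdab lambdas : R) (x y : 'rV[R]_n.+1) :
  fixed_point_system gamma alphaQ alphaM lambdab lambdas x y <->
  forall k, queue_inflow gamma alphaM lambdab lambdas (queue_state x y) k =
     (alphaQ + alphaM + gamma) * queue_state x y k.
Proof.
split=> [[H1 H2 H3 H4] [i|i] /=|H].
- have [i0|i0] := eqVneq i ord0.
    by rewrite (H1 i) ?i0//; ring.
  by rewrite (H2 i _ (inord_pred_succ i0)); ring.
- have [im|im] := eqVneq i ord_max.
    by rewrite (H4 i) ?im//; ring.
  by rewrite (H3 i _ (inord_succ_max im)); ring.
- split=> [i i0|i j ij|i j ij|i im].
  + by have := H (inl i); rewrite /= -val_eqE /= i0 eqxx; lra.
  + by have := H (inl i); rewrite /= -val_eqE /= ij /= inord_val; lra.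
  + have /ltn_eqF i1 : (i < n)%N by rewrite -ltnS -ij ltn_ord.
    have := H (inr i).
    by rewrite /= -val_eqE /= i1 -ij inord_val; lra.
  + have := H (inr i).
    by case: im => im; rewrite /= -val_eqE /= im eqxx; lra.
Qed.

(** The excess terms are nonnegative whatever the signs of x and y, so the inflow of a coordinate is
    nonnegative once its upstream neighbour is positive. Induction runs from the first x upwards and
    from the last y downwards. *)
Lemma queue_solution_gt0 (R : realType) (n : nat)
    (gamma alphaM lambdab lambdas K : R) (z : R -> 'I_n.+1 + 'I_n.+1 -> R) :
  0 < gamma -> 0 < alphaM -> 0 < lambdab -> 0 < lambdas ->
  forward_solution (fun v k =>
    queue_inflow gamma alphaM lambdab lambdas v k - K * v k) z ->
  (forall k, 0 < z 0 k) -> forall (t : R) k, 0 <= t -> 0 < z t k.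
Proof.
move=> g0 a0 lb0 ls0 [cz Dz] z0.
have pos k : (forall t : R, 0 < t ->
    0 <= queue_inflow gamma alphaM lambdab lambdas (z t) k) ->
    forall t : R, 0 <= t -> 0 < z t k.
  move=> B0; apply: (@is_derive_gt0 _ (fun t => z t k) _ K (cz k) _ _ (z0 k)).
    by move=> t t0; exact: Dz.
  by move=> t t0 /=; rewrite mulNr lerDr; exact: B0.
have ex0 (v : 'I_n.+1 + 'I_n.+1 -> R) i :
    0 <= gamma * (v (inl i) - Num.min (v (inl i)) (v (inr i))).
  by rewrite mulr_ge0 ?(ltW g0)// subr_ge0 ge_min lexx.
have ey0 (v : 'I_n.+1 + 'I_n.+1 -> R) i :
    0 <= gamma * (v (inr i) - Num.min (v (inl i)) (v (inr i))).
  by rewrite mulr_ge0 ?(ltW g0)// subr_ge0 ge_min lexx orbT.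
have posx m (i : 'I_n.+1) : i = m :> nat ->
    forall t : R, 0 <= t -> 0 < z t (inl i).
  elim: m i => [|m IH] i im; apply: pos => t t0 /=; rewrite addr_ge0//.
    by rewrite -val_eqE /= im eqxx ltW.
  rewrite -val_eqE /= im /= mulr_ge0 ?(ltW a0)// ltW// IH ?(ltW t0)//.
  by rewrite inordK// -ltnS -im ltnW// ltnS ltn_ord.
(* Here [m] is the distance to the last index, where [lambdas] enters. *)
have posy m (i : 'I_n.+1) : (i + m)%N = n ->
    forall t : R, 0 <= t -> 0 < z t (inr i).
  elim: m i => [|m IH] i im; apply: pos => t t0 /=; rewrite addr_ge0//.
    by rewrite addn0 in im; rewrite -val_eqE /= im eqxx ltW.
  have i_max : i != ord_max.
    by rewrite -val_eqE /= neq_ltn -[X in (_ < X)%N]im addnS ltnS leq_addr.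
  rewrite (negbTE i_max) mulr_ge0 ?(ltW a0)// ltW// IH ?(ltW t0)//.
  by rewrite inord_succ_max// addSnnS.
move=> t [i|i] t0; first exact: (posx i).
by apply: (posy (n - i)%N) => //; rewrite subnKC// -ltnS.
Qed.

Lemma ode_solution_forward (R : realType) (n : nat)
    (gamma alphaQ alphaM lambdab lambdas : R) (x0 y0 : 'rV[R]_n.+1)
    (x y : R -> 'rV[R]_n.+1) :
  ode_solution gamma alphaQ alphaM lambdab lambdas x0 y0 x y ->
  forward_solution (fun v k => queue_inflow gamma alphaM lambdab lambdas v k -
      (alphaQ + alphaM + gamma) * v k)
    (fun t => queue_state (x `|t|) (y `|t|)).
Proof.
move=> [[x00 y00] cx cy Dxy].
apply: (@forward_solution_normr _ _ _ (fun t => queue_state (x t) (y t))).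
  by move=> [i|i] /=; [rewrite x00; exact: cx|rewrite y00; exact: cy].
by move=> t t0; apply/ode_atP; exact: Dxy.
Qed.

Lemma forward_ode_solution (R : realType) (n : nat)
    (gamma alphaQ alphaM lambdab lambdas : R) (x0 y0 : 'rV[R]_n.+1)
    (z : R -> 'I_n.+1 + 'I_n.+1 -> R) :
  forward_solution (fun v k => queue_inflow gamma alphaM lambdab lambdas v k -
      (alphaQ + alphaM + gamma) * v k) z ->
  z 0 = queue_state x0 y0 ->
  ode_solution gamma alphaQ alphaM lambdab lambdas x0 y0
    (fun t => \row_i z t (inl i)) (fun t => \row_i z t (inr i)).
Proof.
move=> [cz Dz] z0; have zE : (fun t => queue_state (\row_i z t (inl i))
    (\row_i z t (inr i))) = z.
  by apply/funext => t; apply/funext => -[i|i]; rewrite /= mxE.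
have zk k : (fun t => queue_state (\row_i z t (inl i)) (\row_i z t (inr i)) k)
    = (fun t => z t k) by apply/funext => t; rewrite -[in RHS]zE.
split.
- by split; apply/rowP => i; rewrite mxE z0.
- move=> i; rewrite [X in X t @[t --> _]](zk (inl i)).
  have -> : x0 0 i = z 0 (inl i) by rewrite z0.
  by apply: cvg_at_right_filter; exact: cz.
- move=> i; rewrite [X in X t @[t --> _]](zk (inr i)).
  have -> : y0 0 i = z 0 (inr i) by rewrite z0.
  by apply: cvg_at_right_filter; exact: cz.
- move=> t t0; apply/ode_atP => k; rewrite zk.
  have -> : queue_state (\row_i z t (inl i)) (\row_i z t (inr i)) = z t.
    by rewrite -[in RHS]zE.
  exact: Dz.
Qed.

(** * Euclidean convergence and conclusion *)

(** For nonnegative $a_k$, $\sum_k a_k^2\le(\sum_k a_k)^2$, because each $a_k$ is at most the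
    sum. *)
Lemma euclid_dist_le_l1 (R : realType) (n : nat) (x y x' y' : 'rV[R]_n) :
  euclid_dist (x, y) (x', y') <=
  \sum_k `|queue_state x y k - queue_state x' y' k|.
Proof.
set S := \sum_k _.
have S0 : 0 <= S by exact: sumr_ge0.
rewrite -[leRHS]ger0_norm// -sqrtr_sqr ler_sqrt ?sqr_ge0//.
have -> : \sum_(i < n) ((x, y).1 0 i - (x', y').1 0 i) ^+ 2 +
          \sum_(i < n) ((x, y).2 0 i - (x', y').2 0 i) ^+ 2 =
    \sum_k `|queue_state x y k - queue_state x' y' k| ^+ 2.
  rewrite big_sumType /=.
  by congr (_ + _); apply: eq_bigr => i _; rewrite real_normK ?num_real.
rewrite expr2 {1}/S mulr_suml; apply: ler_sum => k _.
by rewrite expr2 ler_wpM2l// /S (bigD1 k)//= lerDl sumr_ge0.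
Qed.

Lemma squeeze_expR_cvg0 (R : realType) (f : R -> R) (S a : R) :
  0 < a -> (forall t : R, 0 <= t -> 0 <= f t <= S * expR (- a * t)) ->
  f t @[t --> +oo] --> (0 : R).
Proof.
move=> a0 fS.
have ca : a * t @[t --> +oo] --> +oo.
  move=> A [M [_ HM]]; exists (M / a); split; first exact: num_real.
  by move=> t /=; rewrite ltr_pdivrMr// mulrC; exact: HM.
apply: (@squeeze_cvgr _ _ _ _ (cst 0) (fun t => S * expR (- a * t))).
- near=> t; apply: fS; near: t; exact: nbhs_pinfty_ge.
- exact: cvg_cst.
- rewrite -[X in _ --> X](mulr0 S); apply: cvgMr.
  under eq_fun do rewrite mulNr.
  exact: (cvg_comp _ _ ca (@cvgr_expR R)).
Unshelve. all: by end_near. Qed.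

Theorem theorem2 (R : realType) (N : nat) (hN : (1 <= N)%N)
    (gamma alphaQ alphaM lambdab lambdas : R)
    (hgamma : 0 < gamma) (halphaQ : 0 < alphaQ) (halphaM : 0 < alphaM)
    (hlambdab : 0 < lambdab) (hlambdas : 0 < lambdas) :
  (forall x0 y0 : 'rV[R]_N, pos_vec x0 -> pos_vec y0 ->
     exists x y : R -> 'rV[R]_N,
       [/\ ode_solution gamma alphaQ alphaM lambdab lambdas x0 y0 x y,
           forall x' y' : R -> 'rV[R]_N,
             ode_solution gamma alphaQ alphaM lambdab lambdas x0 y0 x' y' ->
             forall t : R, 0 <= t -> x' t = x t /\ y' t = y t
         & forall t : R, 0 < t -> pos_vec (x t) /\ pos_vec (y t)]) /\
  (exists xs ys : 'rV[R]_N,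
     [/\ fixed_point_system gamma alphaQ alphaM lambdab lambdas xs ys,
         forall xs' ys' : 'rV[R]_N,
           fixed_point_system gamma alphaQ alphaM lambdab lambdas xs' ys' ->
           xs' = xs /\ ys' = ys
       & forall x0 y0 : 'rV[R]_N, pos_vec x0 -> pos_vec y0 ->
         forall x y : R -> 'rV[R]_N,
           ode_solution gamma alphaQ alphaM lambdab lambdas x0 y0 x y ->
           euclid_dist (x t, y t) (xs, ys) @[t --> +oo] --> (0 : R)]).
Proof.
(* Writing N = n + 1 provides the end indices [ord0] and [ord_max]. *)
case: N hN => [//|n] _.
pose B := queue_inflow (n := n) gamma alphaM lambdab lambdas.
pose K := alphaQ + alphaM + gamma; pose b := alphaM + gamma.
pose F v k := B v k - K * v k.
have b0 : 0 <= b by rewrite /b; lra.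
have K0 : 0 <= K by rewrite /K; lra.
have bK : b - K = - alphaQ by rewrite /b /K; ring.
have Bb v w : \sum_k `|B v k - B w k| <= b * \sum_k `|v k - w k|.
  by apply: queue_inflow_contraction; exact: ltW.
(* The Lipschitz bound is global, so Picard iteration yields a solution for all times at once. *)
have FL k v w : `|F v k - F w k| <= (b + K) * \sum_j `|v j - w j|.
  have -> : F v k - F w k = (B v k - B w k) - K * (v k - w k).
    by rewrite /F; ring.
  apply: le_trans (ler_normB _ _) _; rewrite [leRHS]mulrDl lerD//.
    by apply: le_trans (Bb v w); exact: norm_le_sum.
  rewrite normrM ger0_norm// ler_wpM2l//.
  exact: norm_le_sum.
split=> [x0 y0 x0_gt0 y0_gt0|].
  have [z Fz z0] := picard_existence (queue_state x0 y0) (addr_ge0 b0 K0) FL.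
  exists (fun t => \row_i z t (inl i)), (fun t => \row_i z t (inr i)); split.
  - exact: forward_ode_solution Fz z0.
  - move=> x y xyP t t0.
    (* The initial gap is zero, so the contraction bound makes the gap zero at every t >= 0. *)
    have := l1_contraction b0 Bb (ode_solution_forward xyP) Fz t0.
    case: xyP => [[x00 y00] _ _ _].
    rewrite normr0 z0 x00 y00 [X in X * _]big1; last first.
      by move=> k _; rewrite subrr normr0.
    rewrite mul0r (ger0_norm t0) => /sum_norm_eq0 H.
    split; apply/rowP => i; rewrite mxE; apply/eqP; rewrite -subr_eq0.
      by apply/eqP; exact: (H (inl i)).
    by apply/eqP; exact: (H (inr i)).
  - move=> t t0; have z0_gt0 k : 0 < z 0 k by rewrite z0; case: k => i /=.
    have zt k := queue_solution_gt0 hgamma halphaM hlambdab hlambdas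
      Fz z0_gt0 k (ltW t0).
    by split=> i; rewrite mxE.
have bK' : 0 <= b < K by rewrite b0 /b /K /=; lra.
have [v Bv vuniq] := l1_contraction_fixpoint bK' Bb.
have vE : queue_state (\row_i v (inl i)) (\row_i v (inr i)) = v.
  by apply/funext => -[i|i]; rewrite /= mxE.
exists (\row_i v (inl i)), (\row_i v (inr i)); split.
- by apply/fixed_point_systemP; rewrite vE.
- move=> x y /fixed_point_systemP /vuniq <-.
  by split; apply/rowP => i; rewrite mxE.
- move=> x0 y0 _ _ x y /ode_solution_forward Fxy.
  (* A fixed point is a constant solution, so convergence is the contraction between two solutions,
     at rate [alphaQ]. *)
  have Fv : forward_solution F (fun=> v).
    split=> [k t|t _ k]; first exact: cvg_cst.
    by rewrite /F Bv subrr; exact: is_derive_cst.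
  apply: (@squeeze_expR_cvg0 _ _
    (\sum_k `|queue_state (x `|0|) (y `|0|) k - v k|) _ halphaQ) => t t0.
  rewrite sqrtr_ge0 -bK; apply: le_trans (euclid_dist_le_l1 _ _ _ _) _.
  have := l1_contraction b0 Bb Fxy Fv t0.
  by rewrite (ger0_norm t0) vE; exact.
Qed.
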